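(* Let $\mathbb{X}$ be a Banach space, $\varphi:\mathbb{X}\to\mathbb{R}\cup\{+\infty\}$ a proper lower semicontinuous function, $\mathbf{S}_\varphi:=\{x:\varphi(x)\le0\}$ and $\bar x\in\mathbf{S}_\varphi$. Suppose that ${\rm bd}(\mathbf{S}_\varphi)\subseteq\varphi^{-1}(0)$, that $\varphi$ has the epigraphical Shapiro first order contact property at $\bar x$, and that $\mathbf{S}_\varphi$ has the Shapiro first order contact property around $\bar x$. Then the inequality $\varphi(x)\le0$ has a local error bound at $\bar x$ if and only if $$\limsup_{x\xrightarrow{{\rm bd}(\mathbf{S}_\varphi)}\bar x}\mathbf{e}\big(\{h\in\mathbb{X}:\varphi'_H(x;h)\le1\},\ \mathbf{T}^{\mathbf B}(\mathbf{S}_\varphi,x)\big)<+\infty.$$ Moreover, $$\tau(\mathbf{S}_\varphi,\bar x)=\limsup_{x\xrightarrow{{\rm bd}(\mathbf{S}_\varphi)}\bar x}\mathbf{e}\big(\{h\in\mathbb{X}:\varphi'_H(x;h)\le1\},\ \mathbf{T}^{\mathbf B}(\mathbf{S}_\varphi,x)\big).$$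
   Context: $\mathbf{B}(a,\delta)$ is the open ball with center $a$ and radius $\delta$; ${\rm bd}$ denotes boundary; $\mathbf{d}(x,D):=\inf\{\|x-y\|:y\in D\}$. Excess: $\mathbf{e}(C,D):=\sup_{x\in C}\mathbf{d}(x,D)$, with $\mathbf{e}(\emptyset,D)=0$ if $D\neq\emptyset$ and $=\infty$ otherwise. $\varphi'_H(x;h):=\liminf_{t\to0^+,\,h'\to h}\frac{\varphi(x+th')-\varphi(x)}{t}$ (lower Hadamard directional derivative). Bouligand tangent cone $\mathbf{T}^{\mathbf B}(C,c)$: all $v$ with $v_n\to v$, $t_n\downarrow0$, $c+t_nv_n\in C$. A closed set $C$ has the Shapiro first order contact property at $a\in C$ if for every $\varepsilon>0$ there is $\delta>0$ with $\mathbf{d}(x-u,\mathbf{T}^{\mathbf B}(C,u))\le\varepsilon\|x-u\|$ for all $x,u\in C\cap\mathbf{B}(a,\delta)$; around $\bar x$ means at every point of $C\cap U$ for some neighborhood $U$ of $\bar x$. Epigraphical Shapiro first order contact property at $\bar x$: ${\rm epi}(\varphi)\subseteq\mathbb{X}\times\mathbb{R}$ (norm $\|x\|+|\alpha|$) has the Shapiro first order contact property at $(\bar x,\varphi(\bar x))$. Local error bound at $\bar x$: there exist $\tau,\delta>0$ with $\mathbf{d}(x,\mathbf{S}_\varphi)\le\tau\max\{\varphi(x),0\}$ for all $x\in\mathbf{B}(\bar x,\delta)$; the modulus $\tau(\mathbf{S}_\varphi,\bar x)$ is the infimum of all $\tau>0$ for which such a $\delta$ exists (with $\inf\emptyset=+\infty$).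 $\limsup_{x\xrightarrow{D}\bar x}F(x):=\lim_{\delta\downarrow0}\sup\{F(x):x\in D\cap\mathbf{B}(\bar x,\delta)\}$, with the convention $\sup\emptyset=0$. *)

(* Defs.v *)
From HB Require Import structures.
From mathcomp Require Import all_boot all_order all_algebra.
From mathcomp Require Import all_classical all_reals all_analysis.
Set Implicit Arguments. Unset Strict Implicit. Unset Printing Implicit Defensive.
Import Order.TTheory GRing.Theory Num.Theory.
Import numFieldNormedType.Exports.
Local Open Scope classical_set_scope.
Local Open Scope ring_scope.

Section Defs.
Context {R : realType}.

(* distance from x to D, computed with a given norm N; inf over empty = +oo *)
Definition distN {V : normedModType R} (N : V -> R) (x : V) (D : set V) : \bar R :=
  ereal_inf [set (N (x - y))%:E | y in D].

Definition dist {V : normedModType R} (x : V) (D : set V) : \bar R :=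
  distN (fun v : V => `|v|) x D.

Definition excess {V : normedModType R} (C D : set V) : \bar R :=
  if pselect (C = set0) then (if pselect (D = set0) then +oo%E else 0%E)
  else ereal_sup [set dist x D | x in C].

Definition bouligand {V : normedModType R} (C : set V) (c : V) : set V :=
  [set v | exists (vn : nat -> V) (tn : nat -> R),
     [/\ vn @ \oo --> v, tn @ \oo --> (0:R), (forall n, 0 < tn n)
       & forall n, C (c + tn n *: vn n)]].

Definition shapiro_atN {V : normedModType R} (N : V -> R) (C : set V) (a : V) :=
  forall eps : R, 0 < eps -> exists2 delta : R, 0 < delta &
    forall x u, C x -> N (x - a) < delta -> C u -> N (u - a) < delta ->
      (distN N (x - u)%R (bouligand C u) <= (eps * N (x - u)%R)%:E)%E.

Definition shapiro_at {V : normedModType R} (C : set V) (a : V) :=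
  shapiro_atN (fun v : V => `|v|) C a.

Definition shapiro_around {V : normedModType R} (C : set V) (xbar : V) :=
  exists2 r : R, 0 < r & forall a, C a -> `|a - xbar| < r -> shapiro_at C a.

Definition proper_fun {X : Type} (phi : X -> \bar R) :=
  (forall x, phi x != -oo%E) /\ exists x, phi x != +oo%E.

Definition epigraph {X : Type} (phi : X -> \bar R) : set (X * R) :=
  [set p | (phi p.1 <= p.2%:E)%E].

Definition epi_shapiro_at {X : normedModType R} (phi : X -> \bar R) (xbar : X) :=
  shapiro_atN (fun p : X * R => `|p.1| + `|p.2|) (epigraph phi) (xbar, fine (phi xbar)).

Definition sublevel0 {X : Type} (phi : X -> \bar R) : set X := [set x | (phi x <= 0)%E].

Definition bd {X : topologicalType} (A : set X) : set X := closure A `\` interior A.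

Definition hadamard_lower {X : normedModType R} (phi : X -> \bar R) (x h : X) : \bar R :=
  limf_einf (fun p : R * X => ((phi (x + p.1 *: p.2)%R - phi x) * (p.1^-1)%:E)%E)
    (filter_prod (at_right (0:R)) (nbhs h)).

Definition error_bound_with {X : normedModType R} (phi : X -> \bar R) (xbar : X) (tau : R) :=
  exists2 delta : R, 0 < delta & forall x, `|x - xbar| < delta ->
    (dist x (sublevel0 phi) <= tau%:E * maxe (phi x) 0)%E.

Definition local_error_bound {X : normedModType R} (phi : X -> \bar R) (xbar : X) :=
  exists2 tau : R, 0 < tau & error_bound_with phi xbar tau.

Definition eb_modulus {X : normedModType R} (phi : X -> \bar R) (xbar : X) : \bar R :=
  ereal_inf [set tau%:E | tau in [set tau : R | 0 < tau /\ error_bound_with phi xbar tau]].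

Definition sup0 (A : set (\bar R)) : \bar R :=
  if pselect (A = set0) then 0%E else ereal_sup A.

Definition limsup_within {X : normedModType R} (D : set X) (F : X -> \bar R) (xbar : X) : \bar R :=
  lim ((fun delta : R => sup0 (F @` (D `&` [set x | `|x - xbar| < delta]))) @ at_right (0:R)).

End Defs.

(* Main.v *)
(** Write S for the sublevel set of phi and T for Bouligand tangent cones.

    If tau is an error bound constant and phi'_H(x; h) <= 1 at a boundary point x
    of S, there are t > 0 small and w near h with phi(x + t w) <= t (1 + o(1)),
    hence some s in S at distance at most about t tau from x + t w.  The quotient
    (s - x) / t need not converge, but the Shapiro property of S at x puts it close
    to T(S, x), so h is within about tau of that cone.

    Conversely, for x outside S near xbar, Ekeland's principle on S produces u in S
    minimising |x - w| + e |w - u| over w in S.  Convexity of the norm then gives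
    (1 - e) |x - u| <= (1 + e) |x - u - v| for every v in T(S, u); in particular u is
    a boundary point.  The Shapiro property of the epigraph approximates
    (x - u, phi x) by some (h, r) in T(epi phi, (u, 0)), so phi'_H(u; h) <= r, and the
    excess bound at u approximates h by some v in T(S, u).  Letting e tend to 0,
    |x - u| is at most tau phi(x) for any tau above the limit superior. *)

Require Import Defs.
From HB Require Import structures.
From mathcomp Require Import all_boot all_order all_algebra.
From mathcomp Require Import all_classical all_reals all_analysis.
From mathcomp Require Import lra.
Import Order.TTheory GRing.Theory Num.Theory.
Import numFieldNormedType.Exports.
Local Open Scope classical_set_scope.
Local Open Scope ring_scope.
Set Implicit Arguments.
Unset Strict Implicit.
Unset Printing Implicit Defensive.

Lemma small_mul_lt (R : realFieldType) (e A B : R) : 0 < e -> 0 < A -> 0 < B ->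
  exists2 d, 0 < d & d <= e /\ d * A < B.
Proof.
move=> e0 A0 B0; exists (Num.min e (B / (2 * A))).
  by rewrite lt_min e0 divr_gt0 ?mulr_gt0.
split; first by rewrite ge_min lexx.
have : Num.min e (B / (2 * A)) <= B / (2 * A) by rewrite ge_min lexx orbT.
rewrite ler_pdivlMr ?mulr_gt0//; lra.
Qed.

(** * Distances and excesses *)

Section Distance.
Context {R : realType} {V : normedModType R}.
Implicit Types (N : V -> R) (x y : V) (D : set V).

Lemma distN_le N x D y : D y -> (distN N x D <= (N (x - y))%:E)%E.
Proof. by move=> Dy; apply: ereal_inf_lbound; exists y. Qed.

Lemma dist_le x D y : D y -> (dist x D <= `|x - y|%:E)%E.
Proof. exact: distN_le. Qed.

Lemma distN_lt N x D (a : R) :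
  (distN N x D < a%:E)%E -> exists2 y, D y & N (x - y) < a.
Proof. by move=> /ereal_inf_lt[_ [y Dy <-]]; rewrite lte_fin; exists y. Qed.

Lemma dist_ge0 x D : (0 <= dist x D)%E.
Proof. by apply: le_ereal_inf_tmp => _ [y _ <-]; rewrite lee_fin. Qed.

Lemma dist_le_approx x D (a C : R) : 0 < C ->
  (forall e, 0 < e -> e <= 1 -> exists2 y, D y & `|x - y| <= a + e * C) ->
  (dist x D <= a%:E)%E.
Proof.
move=> C0 H; apply/lee_addgt0Pr => e e0.
have [d d0 [d1 dC]] := small_mul_lt (@ltr01 R) C0 e0.
have [y Dy xy] := H d d0 d1.
by apply: le_trans (dist_le _ Dy) _; rewrite -EFinD lee_fin; lra.
Qed.

Lemma excess_ge0 (C D : set V) : (0 <= excess C D)%E.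
Proof.
rewrite /excess; case: pselect => [?|C0] /=.
  by case: pselect => [?|?] /=; rewrite ?leey.
move/eqP/set0P: C0 => [c Cc].
by apply: le_trans (dist_ge0 c D) (ereal_sup_ubound _); exists c.
Qed.

(** With [C] nonempty, the conventional values of the excess do not intervene. *)
Lemma excess_leP (C D : set V) (a : R) : C !=set0 ->
  (excess C D <= a%:E)%E <-> forall c, C c -> (dist c D <= a%:E)%E.
Proof.
move=> C0; rewrite /excess; case: pselect => [C0'|?] /=.
  by move/set0P/eqP: C0.
split=> [H c Cc|H]; last by apply: ge_ereal_sup => _ [c Cc <-]; exact: H.
by apply: le_trans H; apply: ereal_sup_ubound; exists c.
Qed.

End Distance.

(** * Tangent vectors *)

Section Contingent.
Context {R : realType} {V : normedModType R}.
Implicit Types (C : set V) (c v : V).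

(* The sequence-free form of [bouligand]. *)
Definition contingent C c v := forall e : R, 0 < e ->
  exists t w, [/\ 0 < t, t < e, `|w - v| < e & C (c + t *: w)].

Lemma bouligand_contingent C c v : bouligand C c v -> contingent C c v.
Proof.
move=> [vn [tn [/cvgrPdist_lt vv /cvgrPdist_lt t0 tn0 Cn]]] e e0.
near \oo => n; exists (tn n), (vn n); split => //.
  have : `|0 - tn n| < e by near: n; exact: t0.
  by rewrite sub0r normrN gtr0_norm.
by rewrite distrC; near: n; exact: vv.
Unshelve. all: by end_near. Qed.

Lemma bouligandZ C c v (a : R) : 0 < a -> bouligand C c v -> bouligand C c (a *: v).
Proof.
move=> a0 [vn [tn [vv t0 tn0 Cn]]].
exists (fun n => a *: vn n), (fun n => a^-1 * tn n); split.
- exact: cvgZr.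
- by rewrite -[0](mulr0 a^-1); exact: cvgMr.
- by move=> n; rewrite mulr_gt0// invr_gt0.
- by move=> n; rewrite scalerA mulrAC mulVf ?gt_eqF// mul1r.
Qed.

Lemma interior_contingent v C c : (interior C) c -> contingent C c v.
Proof.
move=> /nbhs_ballP[r /= r0 Cr] e e0.
have v0 : 0 < `|v| + 1 by rewrite ltr_wpDl.
have e20 : 0 < e / 2 by lra.
have [d d0 [de dv]] := small_mul_lt e20 v0 r0.
exists d, v; split => //; [lra|by rewrite subrr normr0|].
apply: Cr; rewrite -ball_normE /ball_ /= opprD addNKr normrN normrZ gtr0_norm//.
by apply: le_lt_trans dv; rewrite ler_pM2l// lerDl.
Qed.

End Contingent.

(** * The lower Hadamard derivative at zeros of [phi] *)

Section Hadamard.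
Context {R : realType} {X : normedModType R} (phi : X -> \bar R).

(** The lower limit is a supremum of infima over the sets of the filter, so on each such set the
    infimum is below [r + e], and hence some quotient is too. *)
Lemma hadamard_lower_le_approx x h (r : R) : phi x = 0%E ->
  (hadamard_lower phi x h <= r%:E)%E -> forall e : R, 0 < e ->
  exists t w, [/\ 0 < t, t < e, `|w - h| < e & (phi (x + t *: w)%R <= (t * (r + e))%:E)%E].
Proof.
move=> phix0 + e e0; rewrite /hadamard_lower limf_einfE => H.
set f := (X in [set ereal_inf (X @` _) | _ in _]) in H.
pose V := [set p : R * X | [/\ 0 < p.1, p.1 < e & `|p.2 - h| < e]].
have FV : filter_prod (at_right (0:R)) (nbhs h) V.
  exists ([set t | 0 < t < e], [set w | `|w - h| < e]) => /=.
    split.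
      near=> t; apply/andP; split; near: t; [exact: nbhs_right_gt|exact: nbhs_right_lt].
    by apply/nbhs_normP; exists e => // w /=; rewrite distrC.
  by move=> [t w] [/= /andP[t0 te] wh].
have : (ereal_inf (f @` V) < (r + e)%:E)%E.
  apply: le_lt_trans (_ : (_ <= r%:E)%E) _; last by rewrite lte_fin ltrDl.
  by apply: le_trans H; apply: ereal_sup_ubound; exists V.
move=> /ereal_inf_lt[_ [[t w] [/= t0 te wh] <-]].
rewrite /f /= phix0 sube0 => ltre; exists t, w; split => //.
have := ltW ltre; rewrite -(@lee_pmul2r _ t%:E)//.
by rewrite -muleA -!EFinM mulVf ?gt_eqF// mule1 mulrC.
Unshelve. all: by end_near. Qed.

Lemma hadamard_lower_le x h (r : R) : phi x = 0%E ->
  (forall e : R, 0 < e -> exists t w,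
    [/\ 0 < t, t < e, `|w - h| < e & (phi (x + t *: w)%R <= (t * (r + e))%:E)%E]) ->
  (hadamard_lower phi x h <= r%:E)%E.
Proof.
move=> phix0 H; rewrite /hadamard_lower limf_einfE; apply: ge_ereal_sup => _ [V FV <-].
case: FV => -[A B] /= [FA FB] ABV.
move: FA => /nbhs_normP[a /= a0 aA]; move: FB => /nbhs_normP[b /= b0 bB].
apply/lee_addgt0Pr => e e0.
(* Being below [a] and [b] puts the point in [V]; being below [e] keeps its quotient at most
   [r + e]. *)
pose d := Num.min e (Num.min a b).
have d0 : 0 < d by rewrite !lt_min e0 a0 b0.
have [t [w [t0 td wd phitw]]] := H d d0.
have : (d <= e) && ((d <= a) && (d <= b)) by rewrite -!le_min.
move=> /and3P[de da db].
apply: le_trans (_ : (_ <= (phi (x + t *: w)%R - phi x) * (t^-1)%:E)%E) _.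
  apply: ereal_inf_lbound; exists (t, w) => //; apply: ABV; split => /=.
    by apply: aA => //=; rewrite sub0r normrN gtr0_norm//; exact: lt_le_trans da.
  by apply: bB; rewrite /= distrC; exact: lt_le_trans db.
rewrite phix0 sube0 -(@lee_pmul2r _ t%:E)// -muleA -EFinM mulVf ?gt_eqF// mule1.
by apply: le_trans phitw _; rewrite -EFinD -EFinM lee_fin mulrC ler_pM2r//; lra.
Qed.

(** Puts 0 in the set of directions whose excess is taken, so that [excess_leP] applies. *)
Lemma hadamard_lower0 x : phi x = 0%E -> (hadamard_lower phi x 0%R <= 0)%E.
Proof.
move=> phix0; apply: hadamard_lower_le => // e e0; exists (e / 2), 0.
split; [lra|lra|by rewrite subrr normr0|].
by rewrite scaler0 addr0 phix0 lee_fin; nra.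
Qed.

(** Epigraph points [(x + t *: w, t * q)] with [(w, q)] near [(h, r)] have difference quotient at
    most [q]. *)
Lemma epigraph_tangent_hadamard x h (r : R) : phi x = 0%E ->
  bouligand (epigraph phi) (x, 0) (h, r) -> (hadamard_lower phi x h <= r%:E)%E.
Proof.
move=> phix0 /bouligand_contingent T; apply: hadamard_lower_le => // e e0.
have [t [[w q] [t0 te]]] := T e e0.
rewrite prod_normE /= gt_max => /andP[wh qr] /= phitw.
exists t, w; split => //; apply: le_trans phitw _.
rewrite /= add0r lee_fin ler_pM2l//.
by move: qr; rewrite ltr_norml; lra.
Qed.

End Hadamard.

(** * Upper limits along a set *)

Section LimsupWithin.
Context {R : realType} {X : normedModType R} (D : set X) (F : X -> \bar R) (xbar : X).

Let G (d : R) : \bar R := Defs.sup0 (F @` (D `&` [set x | `|x - xbar| < d])).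

(** Since [F] is nonnegative on [D], the value 0 for an empty supremum keeps [G] nondecreasing, so
    its right limit at 0 is an infimum. *)
Lemma limsup_withinE : (forall x, D x -> (0 <= F x)%E) ->
  limsup_within D F xbar = ereal_inf [set G d | d in [set d | 0 < d]].
Proof.
move=> F0.
have Gmono : {homo G : d e / d <= e >-> (d <= e)%E}.
  move=> d e de; rewrite /G /Defs.sup0; case: pselect => [?|dN0] /=.
    case: pselect => [//|eN0] /=; move/eqP/set0P: eN0 => [_ [x [Dx xe] _]].
    by apply: le_trans (F0 x Dx) (ereal_sup_ubound _); exists x.
  move/eqP/set0P: dN0 => [_ [x [Dx xd] _]].
  case: pselect => [E|?] /=.
    exfalso; rewrite -[False]/(set0 (F x)) -E; exists x => //; split => //=.
    exact: lt_le_trans xd de.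
  apply: ereal_sup_le => _ [y [Dy yd] <-]; exists y => //; split => //=.
  exact: lt_le_trans yd de.
rewrite /limsup_within; apply: cvg_lim => //.
have := @nondecreasing_at_right_cvge R G 0 (BInfty R false) isT (in2W Gmono).
suff -> : [set` Interval (BRight 0) (BInfty R false)] = [set d | 0 < d] by [].
by apply/seteqP; split => d; rewrite /= in_itv /= andbT.
Qed.

Lemma limsup_within_ge0 : (forall x, D x -> (0 <= F x)%E) ->
  (0 <= limsup_within D F xbar)%E.
Proof.
move=> F0; rewrite limsup_withinE//; apply: le_ereal_inf_tmp => _ [d d0 <-].
rewrite /G /Defs.sup0; case: pselect => [//|dN0] /=.
move/eqP/set0P: dN0 => [_ [x [Dx xd] _]].
by apply: le_trans (F0 x Dx) (ereal_sup_ubound _); exists x.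
Qed.

Lemma limsup_within_le (d : R) (a : \bar R) : (forall x, D x -> (0 <= F x)%E) ->
  0 < d -> (0 <= a)%E -> (forall x, D x -> `|x - xbar| < d -> (F x <= a)%E) ->
  (limsup_within D F xbar <= a)%E.
Proof.
move=> F0 d0 a0 Fa; rewrite limsup_withinE//.
apply: le_trans (_ : (_ <= G d)%E) _; first by apply: ereal_inf_lbound; exists d.
rewrite /G /Defs.sup0; case: pselect => [//|dN0] /=.
by apply: ge_ereal_sup => _ [x [Dx xd] <-]; exact: Fa.
Qed.

Lemma limsup_within_lt (a : \bar R) : (forall x, D x -> (0 <= F x)%E) ->
  (limsup_within D F xbar < a)%E ->
  exists2 d : R, 0 < d & forall x, D x -> `|x - xbar| < d -> (F x < a)%E.
Proof.
move=> F0; rewrite limsup_withinE// => /ereal_inf_lt[_ [d d0 <-] Ga].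
exists d => // x Dx xd; apply: le_lt_trans Ga.
have Fx : (F @` (D `&` [set x | `|x - xbar| < d])) (F x) by exists x.
rewrite /G /Defs.sup0; case: pselect => [E|?] /=; first by rewrite E in Fx.
exact: ereal_sup_ubound.
Qed.

End LimsupWithin.

(** * Ekeland's principle and its tangential form *)

Section Ekeland.
Context {R : realType} {X : completeNormedModType R}.

Lemma ekeland (S : set X) (f : X -> R) (m e : R) (u0 : X) :
  closed S -> continuous f -> (forall w, m <= f w) -> 0 < e -> S u0 ->
  exists u, [/\ S u, f u + e * `|u - u0| <= f u0 &
    forall w, S w -> f u <= f w + e * `|w - u|].
Proof.
move=> Scl fcont mf e0 Su0.
(* Each term of [un] nearly minimises f among the points below its predecessor, so
   the sets [below (un n)] shrink to a point. *)
pose below u w := S w /\ f w + e * `|w - u| <= f u.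
have below_trans u v w : below u v -> below v w -> below u w.
  move=> [Sv uv] [Sw vw]; split => //.
  have : e * `|w - u| <= e * (`|w - v| + `|v - u|).
    by rewrite ler_pM2l// ler_distD.
  lra.
have below_refl u : S u -> below u u.
  by move=> Su; split => //; rewrite subrr normr0 mulr0 addr0.
have step (p : nat * X) : exists w, S p.2 -> below p.2 w /\
    forall z, below p.2 z -> f w <= f z + p.1.+1%:R^-1.
  case: p => n u /=; have [Su|nSu] := pselect (S u); last by exists u.
  have infB : has_inf (f @` below u).
    split; first by exists (f u); exists u => //; exact: below_refl.
    by exists m => _ [w _ <-].
  have n0 : 0 < n.+1%:R^-1 :> R by rewrite invr_gt0.
  have [_ [w uw <-] fw] := inf_adherent n0 infB.
  exists w => _; split => // z uz; apply: le_trans (ltW fw) _.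
  by rewrite lerD2r; apply: ge_inf; [exact: infB.2|exists z].
have [g gP] := choice step.
pose un := fix un n := if n is n'.+1 then g (n', un n') else u0.
have Sun n : S (un n).
  by elim: n => //= n IH; have [[]] := gP (n, un n) IH.
have unP n : below (un n) (un n.+1) /\
    forall z, below (un n) z -> f (un n.+1) <= f z + n.+1%:R^-1.
  exact: gP (n, un n) (Sun n).
have un_below n k : below (un n) (un (n + k)%N).
  elim: k => [|k IH]; first by rewrite addn0; exact: below_refl.
  rewrite addnS; apply: below_trans IH _.
  by have [] := unP (n + k)%N.
(* Such a [z] is also below [un n], so the choice of [un n.+1] caps the drop [f (un n.+1) - f z],
   which dominates [e * |z - un n.+1|]. *)
have below_near n z : below (un n.+1) z -> e * `|z - un n.+1| <= n.+1%:R^-1.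
  move=> zn; have [nn /(_ z (below_trans _ _ _ nn zn))] := unP n.
  by case: zn => _ /le_trans/[apply]; rewrite lerD2l.
have small d : 0 < d -> exists n, forall z, below (un n) z -> `|un n - z| < d.
  move=> d0; have ed0 : 0 < e * d by rewrite mulr_gt0.
  near \oo => n; exists n.+1 => z /below_near zn.
  rewrite distrC -(ltr_pM2l e0); apply: le_lt_trans zn _; near: n.
  exact: (near_infty_natSinv_lt (PosNum ed0)).
have uncvg : cvg (un @ \oo).
  apply: cauchy_cvg; apply: cauchy_exP => d d0.
  have [n nP] := small d d0; exists (un n).
  exists n => // k /= nk; rewrite -ball_normE /ball_ /=; apply: nP.
  by rewrite -(subnKC nk); exact: un_below.
pose u := lim (un @ \oo).
have un_u n : below (un n) u.
  apply: (@closed_cvg _ _ \oo _ un (below (un n))) => //.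
    apply: closedI => //.
    apply: (@preimage_closed _ _ (fun w => f w + e * `|w - un n|) [set x | x <= f (un n)]).
      move=> w _; apply: cvgD; first exact: fcont.
      apply: cvgMr; apply: cvg_norm.
      by apply: cvgB; [exact: cvg_id|exact: cvg_cst].
    exact: closed_le.
  by exists n => // k /= nk; rewrite -(subnKC nk); exact: un_below.
exists u; split; [by case: (un_u 0%N)|by case: (un_u 0%N)|].
move=> w Sw; rewrite leNgt; apply/negP => wu.
(* A violating [w] lies below [u], hence below every [un n]; as these sets shrink to a point,
   [w = u]. *)
have uw : below u w by split => //; exact: ltW.
suff wE : w = u by move: wu; rewrite wE subrr normr0 mulr0 addr0 ltxx.
apply/eqP; rewrite -subr_eq0 -normr_le0; apply/ler_addgt0Pr => d d0; rewrite add0r.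
have d20 : 0 < d / 2 by lra.
have [n nP] := small _ d20.
have := nP w (below_trans _ _ _ (un_u n) uw); have := nP u (un_u n).
by have := ler_distD (un n) w u; rewrite (distrC w (un n)); lra.
Unshelve. all: by end_near. Qed.

(** For [u + t *: w] in [S], convexity of the norm and division by [t] give
    [|x - u| <= |x - u - w| + e * |w|]. Let [w] tend to [v] and bound [|v|] by
    [|x - u| + |x - u - v|]. *)
Lemma ekeland_tangent (S : set X) (x u v : X) (e : R) : 0 < e ->
  (forall w, S w -> `|x - u| <= `|x - w| + e * `|w - u|) ->
  contingent S u v -> (1 - e) * `|x - u| <= (1 + e) * `|x - u - v|.
Proof.
move=> e0 uP Tv; apply/ler_addgt0Pr => d d0.
have e1 : 0 < 1 + e by lra.
(* [c <= 1] keeps [1 - t] positive; [c * (1 + e)] is the error that [H4] and [H5] contribute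
   together. *)
have [c c0 [c1 ce]] := small_mul_lt (@ltr01 R) e1 d0.
have [t [w [t0 tc wv Sw]]] := Tv c c0.
have := uP _ Sw; rewrite addrAC subrr add0r normrZ gtr0_norm// opprD addrA.
have -> : x - u - t *: w = (1 - t) *: (x - u) + t *: (x - u - w).
  by rewrite scalerBl scale1r [t *: (x - u - w)]scalerBr addrA subrK.
have := ler_normD ((1 - t) *: (x - u)) (t *: (x - u - w)).
rewrite !normrZ (gtr0_norm t0) (@gtr0_norm _ (1 - t)); last lra.
move=> H1 H2.
have H3 : `|x - u| <= `|x - u - w| + e * `|w|.
  rewrite -(ler_pM2l t0); lra.
have H4 : `|x - u - w| <= `|x - u - v| + c.
  have -> : x - u - w = (x - u - v) - (w - v) by rewrite opprB addrA subrK.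
  by apply: le_trans (ler_normB _ _) _; lra.
have H5 : `|w| <= `|x - u| + `|x - u - v| + c.
  have -> : w = (w - v) + ((x - u) - (x - u - v)) by rewrite opprB addrC subrKC subrKC.
  by apply: le_trans (ler_normD _ _) _; have := ler_normB (x - u) (x - u - v); lra.
by nra.
Qed.

End Ekeland.

(** * Error bound constants against tangent excesses *)

Lemma error_constant (R : realFieldType) (k tau : R) : 0 <= k -> k < tau ->
  exists2 e : R, 0 < e /\ e < 1 & forall a p : R, 0 <= a -> 0 <= p ->
    (1 - e) * a <= (1 + e) * (e * (a + p) + k * (p + e * (a + p))) -> a <= tau * p.
Proof.
(* Here [a] stands for [|x - u|] and [p] for [phi x]. Bounding [e * e] by [e] gives
   [c2 + tau * (1 - c1) <= k + e * D], so [e * D = tau - k] yields [c2 <= tau * c1]. *)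
move=> k0 kt; pose D := 2 + 3 * k + tau * (5 + 2 * k).
have tau0 : 0 < tau by lra.
have D0 : 0 < D by rewrite /D; nra.
pose e := (tau - k) / D.
have eD : e * D = tau - k by rewrite /e divfK// gt_eqF.
have e0 : 0 < e by rewrite divr_gt0// subr_gt0.
have ek0 : 0 <= e * k by rewrite mulr_ge0// ltW.
have et0 : 0 < e * tau by rewrite mulr_gt0.
have ekt0 : 0 <= e * k * tau by rewrite mulr_ge0// ltW.
have e1 : e < 1.
  by rewrite -(ltr_pM2r tau0) mul1r; move: eD; rewrite /D; lra.
exists e => // a p a0 p0 H.
pose c1 := 1 - e - (1 + e) * e * (1 + k); pose c2 := (1 + e) * (e + k + k * e).
have ee : e * e <= e by rewrite ger_pMr// ltW.
have eek : e * e * k <= e * k by rewrite ler_wpM2r.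
have eekt : e * e * k * tau <= e * k * tau by rewrite ler_wpM2r// ltW.
have eet : e * e * tau <= e * tau by rewrite ler_wpM2r// ltW.
have c12 : c2 <= tau * c1 by rewrite /c1 /c2; move: eD; rewrite /D; lra.
have c10 : 0 < c1.
  by rewrite -(pmulr_rgt0 _ tau0); apply: lt_le_trans c12; rewrite /c2; nra.
have H' : c1 * a <= c2 * p by rewrite /c1 /c2; lra.
rewrite -(ler_pM2l c10); apply: le_trans H' _.
by rewrite mulrA (mulrC c1) ler_wpM2r.
Qed.

Lemma sublevel0_closed (R : realType) (X : normedModType R) (phi : X -> \bar R) :
  lower_semicontinuous phi -> closed (sublevel0 phi).
Proof.
move=> /lower_semicontinuousP/(_ 0) phi0; rewrite -[sublevel0 phi]setCK closedC.
by rewrite (_ : ~` _ = [set x | (0%:E < phi x)%E])//;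
  apply/seteqP; split => x; rewrite /sublevel0 /= ltNge => /negP.
Qed.

Lemma error_bound_dist_tangent (R : realType) (X : normedModType R)
    (phi : X -> \bar R) (xbar : X) (tau delta : R) : 0 < tau ->
  (forall x, `|x - xbar| < delta ->
    (dist x (sublevel0 phi) <= tau%:E * maxe (phi x) 0)%E) ->
  forall x h, phi x = 0%E -> `|x - xbar| < delta -> shapiro_at (sublevel0 phi) x ->
  (hadamard_lower phi x h <= 1)%E ->
  (dist h (bouligand (sublevel0 phi) x) <= tau%:E)%E.
Proof.
move=> tau0 EB x h phix0 xd sh hle.
have h0 := normr_ge0 h.
(* [t * M] will bound [|s - x|]: [|w|] is at most [|h| + 1], and [s] is within [t * (2 * tau + 1)]
   of [x + t *: w]. *)
pose M := `|h| + 2 + 2 * tau; have M0 : 0 < M by rewrite /M; lra.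
have C0 : 0 < 2 + tau + 2 * M by lra.
apply: (dist_le_approx C0) => e e0 e1.
have [d1 d10 shd1] := sh e e0.
have h10 : 0 < `|h| + 1 by lra.
have dx0 : 0 < delta - `|x - xbar| by rewrite subr_gt0.
(* [c] keeps [s] within the Shapiro radius [d1]; [d] keeps [x + t *: w] where the error bound
   holds. *)
have [c c0 [ce cM]] := small_mul_lt e0 M0 d10.
have [d d0 [dc dh]] := small_mul_lt c0 h10 dx0.
have dM : d * M < d1 by apply: le_lt_trans cM; rewrite ler_pM2r.
have [t [w [t0 td wh phitw]]] := hadamard_lower_le_approx phix0 hle d0.
have wh' : `|w| <= `|h| + e.
  by rewrite -[w](subrK h); apply: le_trans (ler_normD _ _) _; lra.
have twd : `|x + t *: w - xbar| < delta.
  rewrite addrAC; apply: le_lt_trans (ler_normD _ _) _.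
  rewrite normrZ gtr0_norm//.
  have : t * `|w| <= d * (`|h| + 1) by apply: ler_pM => //; lra.
  lra.
(* The extra [e * t] makes the inequality strict, so that some [s] realises it. *)
have : (dist (x + t *: w)%R (sublevel0 phi) < ((tau * (1 + e) + e) * t)%:E)%E.
  apply: le_lt_trans (EB _ twd) _.
  apply: le_lt_trans (_ : (_ <= (tau * (t * (1 + e)))%:E)%E) _.
    rewrite EFinM lee_pmul2l// ge_max lee_fin; apply/andP; split; last first.
      by apply: mulr_ge0; lra.
    by apply: le_trans phitw _; rewrite lee_fin ler_pM2l//; lra.
  rewrite lte_fin; have := mulr_gt0 e0 t0; lra.
move=> /distN_lt[s Ss xs].
have sx : `|s - x| <= t * M.
  have -> : s - x = t *: w - (x + t *: w - s).
    by rewrite opprB opprD [- x - _]addrC addrCA addNKr.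
  apply: le_trans (ler_normB _ _) _; rewrite normrZ gtr0_norm//.
  have : t * (`|w| + (tau * (1 + e) + e)) <= t * M.
    rewrite ler_pM2l// /M; have : tau * e <= tau by rewrite ger_pMr.
    lra.
  lra.
have sd1 : `|s - x| < d1.
  by apply: le_lt_trans sx _; apply: lt_trans dM; rewrite ltr_pM2r.
have Sx : sublevel0 phi x by rewrite /sublevel0 /= phix0.
have := shd1 s x Ss sd1 Sx; rewrite subrr normr0 => /(_ d10) dsx.
have : (dist (s - x)%R (bouligand (sublevel0 phi) x) < (2 * e * t * M)%:E)%E.
  apply: le_lt_trans dsx _; rewrite lte_fin.
  apply: le_lt_trans (_ : e * `|s - x| <= e * (t * M)) _; first by rewrite ler_pM2l.
  by have := mulr_gt0 e0 (mulr_gt0 t0 M0); lra.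
move=> /distN_lt[v Tv sv].
have ti0 : 0 < t^-1 by rewrite invr_gt0.
exists (t^-1 *: v); first exact: bouligandZ.
(* The three differences are controlled by the choice of [w], the error bound and the Shapiro
   property. *)
have -> : h - t^-1 *: v = (h - w) + t^-1 *: ((x + t *: w - s) + (s - x - v)).
  rewrite -(addrA s) subrKA [x + _]addrC addrA addrK.
  by rewrite scalerBr scalerA mulVf ?gt_eqF// scale1r addrA subrK.
apply: le_trans (ler_normD _ _) _; rewrite distrC normrZ (gtr0_norm ti0).
have : t^-1 * `|x + t *: w - s + (s - x - v)| <= tau * (1 + e) + e + 2 * e * M.
  rewrite ler_pdivrMl//; apply: le_trans (ler_normD _ _) _; lra.
lra.
Qed.

(** With [a = |x - u|] for the Ekeland point [u], the term [e * (a + p)] is the error of the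
    epigraphical approximation, and the term with factor [k] is the rescaled excess bound.
    [error_constant] then solves for [a]. *)
Lemma dist_sublevel0_estimate (R : realType) (X : completeNormedModType R)
    (phi : X -> \bar R) (xbar x : X) (e k d p : R) :
  closed (sublevel0 phi) ->
  bd (sublevel0 phi) `<=` phi @^-1` [set 0%E] ->
  sublevel0 phi xbar -> phi x = p%:E -> 0 < p -> 0 < e -> e < 1 ->
  (forall y u, epigraph phi y -> `|y.1 - xbar| + `|y.2| < d ->
     epigraph phi u -> `|u.1 - xbar| + `|u.2| < d ->
     (distN (fun q : X * R => `|q.1| + `|q.2|)%R (y - u)%R (bouligand (epigraph phi) u)
        <= (e / 2 * (`|(y - u).1| + `|(y - u).2|))%:E)%E) ->
  (forall u, bd (sublevel0 phi) u -> `|u - xbar| < d ->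
     (excess [set h | (hadamard_lower phi u h <= 1)%E]
             (bouligand (sublevel0 phi) u) < k%:E)%E) ->
  2 * `|x - xbar| + p < d ->
  exists2 a : R, 0 <= a /\ (dist x (sublevel0 phi) <= a%:E)%E &
    (1 - e) * a <= (1 + e) * (e * (a + p) + k * (p + e * (a + p))).
Proof.
move=> Scl bd0 Sxbar phix p0 e0 e1 shapiro exk xd.
have nSx : ~ sublevel0 phi x by rewrite /sublevel0 /= phix lee_fin; lra.
have fcont : continuous (fun w => `|x - w|).
  by move=> w; apply: cvg_norm; apply: cvgB; [exact: cvg_cst|exact: cvg_id].
have [u [Su uxbar uP]] := ekeland Scl fcont (fun w => normr_ge0 (x - w)) e0 Sxbar.
have a0 : 0 < `|x - u|.
  by rewrite normr_gt0 subr_eq0; apply/eqP => xu; apply: nSx; rewrite xu.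
have bdu : bd (sublevel0 phi) u.
  split; first exact: subset_closure.
  move=> /(interior_contingent (x - u))/(ekeland_tangent e0 uP).
  by rewrite subrr normr0 mulr0 leNgt mulr_gt0// subr_gt0.
have phiu : phi u = 0%E := bd0 _ bdu.
exists `|x - u|; first by split; [exact: ltW|exact: dist_le].
(* Ekeland's descent inequality already gives [|x - u| <= |x - xbar|]. *)
have uxb : `|u - xbar| <= 2 * `|x - xbar|.
  have : 0 <= e * `|u - xbar| by rewrite mulr_ge0// ltW.
  have := ler_distD x u xbar; rewrite (distrC u x); lra.
have ud : `|u - xbar| < d by lra.
have xb0 := normr_ge0 (x - xbar).
have epix : epigraph phi (x, p) by rewrite /epigraph /= phix.
have epiu : epigraph phi (u, 0) by rewrite /epigraph /= phiu.
have := shapiro _ _ epix _ epiu; rewrite /= normr0 addr0 (gtr0_norm p0) => H.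
have {H} := H ltac:(lra) ud; rewrite subr0 (gtr0_norm p0) => H.
have ap0 : 0 < e * (`|x - u| + p) by rewrite mulr_gt0//; lra.
have : (distN (fun q : X * R => `|q.1| + `|q.2|)%R ((x, p) - (u, 0))%R
    (bouligand (epigraph phi) (u, 0%R)) < (e * (`|x - u| + p))%:E)%E.
  by apply: le_lt_trans H _; rewrite lte_fin; lra.
move=> /distN_lt[[h r] Thr] /=; rewrite subr0 => hr.
(* [r] need not be positive; dividing by its positive upper bound [s] gives a direction with
   derivative at most [r / s <= 1]. *)
pose s := p + e * (`|x - u| + p).
have s0 : 0 < s by rewrite /s; lra.
have si0 : 0 < s^-1 by rewrite invr_gt0.
have rs : r <= s.
  have := ler_norm (r - p); have := normr_ge0 (x - u - h).
  by rewrite (distrC r p) /s; lra.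
have hle : [set h | (hadamard_lower phi u h <= 1)%E] (s^-1 *: h).
  apply: le_trans (_ : (_ <= (s^-1 * r)%:E)%E) _.
    by apply: epigraph_tangent_hadamard => //; exact: (bouligandZ si0 Thr).
  by rewrite lee_fin ler_pdivrMl// mulr1.
have : (dist (s^-1 *: h)%R (bouligand (sublevel0 phi) u) < k%:E)%E.
  apply: le_lt_trans (exk _ bdu ud); rewrite /excess.
  case: pselect => [E|?] /=; first by rewrite E in hle.
  by apply: ereal_sup_ubound; exists (s^-1 *: h).
move=> /distN_lt[v Tv hv].
have := ekeland_tangent e0 uP (bouligand_contingent (bouligandZ s0 Tv)).
move=> /le_trans; apply; rewrite ler_pM2l; last lra.
have -> : x - u - s *: v = (x - u - h) + s *: (s^-1 *: h - v).
  by rewrite scalerBr scalerA divff ?gt_eqF// scale1r addrA subrK.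
apply: le_trans (ler_normD _ _) _; rewrite normrZ (gtr0_norm s0).
have : s * `|s^-1 *: h - v| <= s * k by rewrite ler_pM2l// ltW.
by have := normr_ge0 (p - r); rewrite -/s (mulrC k); lra.
Qed.

Lemma error_bound_of_tangent_excess (R : realType) (X : completeNormedModType R)
    (phi : X -> \bar R) (xbar : X) (k tau delta : R) :
  closed (sublevel0 phi) ->
  bd (sublevel0 phi) `<=` phi @^-1` [set 0%E] ->
  sublevel0 phi xbar -> epi_shapiro_at phi xbar -> 0 <= k -> k < tau -> 0 < delta ->
  (forall u, bd (sublevel0 phi) u -> `|u - xbar| < delta ->
     (excess [set h | (hadamard_lower phi u h <= 1)%E]
             (bouligand (sublevel0 phi) u) < k%:E)%E) ->
  error_bound_with phi xbar tau.
Proof.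
move=> Scl bd0 Sxbar epish k0 ktau delta0 exk.
have tau0 : 0 < tau by lra.
have maxe0 x : (0 <= tau%:E * maxe (phi x) 0)%E.
  by apply: mule_ge0; [rewrite lee_fin ltW|rewrite le_max lexx orbT].
have dist0 x : sublevel0 phi x -> (dist x (sublevel0 phi) <= tau%:E * maxe (phi x) 0)%E.
  move=> Sx; apply: le_trans (maxe0 x); rewrite -[0%E]/(0%:E) -(@normr0 _ X) -(subrr x).
  exact: dist_le.
(* At an interior point [phi xbar] may be negative, but distances vanish nearby; otherwise the
   epigraph point is [(xbar, 0)]. *)
have [/nbhs_normP[r r0 rS]|nint] := pselect (interior (sublevel0 phi) xbar).
  exists r => // x xr; apply: dist0; apply: rS; rewrite /= distrC; exact: xr.
have phixbar : phi xbar = 0%E.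
  by apply: bd0; split => //; exact: subset_closure.
have [e [e0 e1] eP] := error_constant k0 ktau.
have e20 : 0 < e / 2 by lra.
have [d1 d10] := epish _ e20; rewrite phixbar /= => shd1.
pose d := Num.min d1 delta.
have d0 : 0 < d by rewrite lt_min d10 delta0.
have dd1 : d <= d1 by rewrite ge_min lexx.
have ddelta : d <= delta by rewrite ge_min lexx orbT.
(* [d / 4] ensures [2 * |x - xbar| + p < d] when [p < d / 2]; [tau * (d / 2)] serves the remaining
   heights. *)
exists (Num.min (d / 4) (tau * (d / 2))).
  by rewrite lt_min divr_gt0//= mulr_gt0// divr_gt0.
move=> x; rewrite lt_min => /andP[xd xtau].
have [Sx|nSx] := pselect (sublevel0 phi x); first exact: dist0.
have : (0 < phi x)%E by rewrite ltNge; apply/negP.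
case phix : (phi x) => [p| |] // p0; last first.
  by rewrite max_l ?leey// gt0_muley ?lte_fin// leey.
rewrite lte_fin in p0; rewrite max_l; last by rewrite lee_fin ltW.
rewrite -EFinM.
(* The Shapiro property only controls points of the epigraph of small height; when
   phi x is large the distance to xbar is already small enough. *)
have [dp|pd] := leP (d / 2) p.
  apply: (@le_trans _ _ `|x - xbar|%:E); first exact: dist_le.
  rewrite lee_fin.
  by apply: le_trans (ltW xtau) _; rewrite ler_pM2l.
have [|||a [a0 xa] aP] :=
  @dist_sublevel0_estimate _ _ phi xbar x e k d p Scl bd0 Sxbar phix p0 e0 e1.
- move=> [y1 y2] [u1 u2] epiy yd epiu ud.
  by have := shd1 _ _ epiy _ epiu; rewrite /= !subr0; apply; exact: lt_le_trans dd1.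
- by move=> u bdu ud; apply: exk => //; exact: lt_le_trans ddelta.
- lra.
by apply: le_trans xa _; rewrite lee_fin; apply: eP => //; exact: ltW.
Qed.

Theorem theorem4p2 (R : realType) (X : completeNormedModType R)
  (phi : X -> \bar R) (xbar : X) :
  proper_fun phi -> lower_semicontinuous phi ->
  sublevel0 phi xbar ->
  bd (sublevel0 phi) `<=` phi @^-1` [set 0%E] ->
  epi_shapiro_at phi xbar ->
  shapiro_around (sublevel0 phi) xbar ->
  let L := limsup_within (bd (sublevel0 phi))
             (fun x => excess [set h | (hadamard_lower phi x h <= 1)%E]
                              (bouligand (sublevel0 phi) x)) xbar in
  (local_error_bound phi xbar <-> (L < +oo)%E) /\ eb_modulus phi xbar = L.
Proof.
move=> _ lsc Sxbar bd0 epish [r r0 shS] L.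
have Scl := sublevel0_closed lsc.
have F0 x : bd (sublevel0 phi) x -> (0 <= excess [set h | (hadamard_lower phi x h <= 1)%E]
    (bouligand (sublevel0 phi) x))%E by move=> _; exact: excess_ge0.
have L0 : (0 <= L)%E by exact: limsup_within_ge0.
have necessity tau : 0 < tau -> error_bound_with phi xbar tau -> (L <= tau%:E)%E.
  move=> tau0 [delta delta0 EB].
  apply: (@limsup_within_le _ _ _ _ _ (Num.min r delta)) => //.
  - by rewrite lt_min r0 delta0.
  - by rewrite lee_fin ltW.
  move=> x bdx; rewrite lt_min => /andP[xr xdelta].
  have phix : phi x = 0%E := bd0 _ bdx.
  apply/excess_leP.
    by exists 0; apply: le_trans (hadamard_lower0 phix) _; rewrite lee_fin.
  move=> h; apply: (error_bound_dist_tangent tau0 EB) => //.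
  by apply: shS => //; rewrite /sublevel0 /= phix.
have sufficiency tau : (L < tau%:E)%E -> 0 < tau /\ error_bound_with phi xbar tau.
  move=> Ltau; have := le_lt_trans L0 Ltau; rewrite lte_fin => tau0; split => //.
  have Lfin : L = (fine L)%:E.
    by rewrite fineK// ge0_fin_numE//; apply: lt_trans Ltau _; rewrite ltry.
  have fL0 : 0 <= fine L by rewrite fine_ge0.
  have fLtau : fine L < tau by rewrite -lte_fin -Lfin.
  (* The midpoint becomes [k]: above [L], it bounds the excess near [xbar], and it leaves the gap
     below [tau] that [error_constant] uses. *)
  have : (L < ((fine L + tau) / 2)%:E)%E by rewrite [X in (X < _)%E]Lfin lte_fin; lra.
  move=> /(limsup_within_lt F0)[delta delta0 exk].
  by apply: (error_bound_of_tangent_excess Scl bd0 Sxbar epish _ _ delta0 exk); lra.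
have modE : eb_modulus phi xbar = L.
  apply/eqP; rewrite eq_le; apply/andP; split.
    case: (eqVneq L +oo%E) => [->|Loo]; first by rewrite leey.
    have Lfin : L = (fine L)%:E by rewrite fineK// ge0_fin_numE// lt_neqAle Loo leey.
    apply/lee_addgt0Pr => e e0; rewrite Lfin -EFinD; apply: ereal_inf_lbound.
    exists (fine L + e) => //; apply: sufficiency.
    by rewrite [X in (X < _)%E]Lfin lte_fin ltrDl.
  by apply: le_ereal_inf_tmp => _ [tau [tau0 EB] <-]; exact: necessity.
(* The modulus is an infimum of reals, finite exactly when some constant exists, so the equivalence
   follows from the equality. *)
split => //; rewrite -modE; split => [[tau tau0 EB]|].
  apply: le_lt_trans (ltry tau); apply: ereal_inf_lbound; exists tau => //.
by move=> /ereal_inf_lt[_ [tau [tau0 EB] <-] _]; exists tau.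
Qed.
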